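(* Let $M$ be a Seifert 3-manifold which is a rational homology sphere, with $e<0$, and let $H=H_1(M,\mathbb{Z})$. Fix an arbitrary $spin^c$ structure $\sigma\in Spin^c(M)$, characterized by $h_\sigma\cdot\sigma_{can}=\sigma$ with $h_\sigma\in H$. Write $h_\sigma=g_0^{a_0}g_1^{a_1}\cdots g_\nu^{a_\nu}$ for some integers $a_0,a_1,\dots,a_\nu$, and define $\tilde a:=\alpha\cdot\big(a_0+\sum_i a_i/\alpha_i\big)$. Then $$\mathcal{T}_{M,\sigma}(1)=\lim_{t\to1}\Big(\sum_{l\in\mathbb{Z}}\max\Big(0,\,1+a_0-lb+\sum_{i=1}^\nu\Big\lfloor\frac{-l\omega_i+a_i}{\alpha_i}\Big\rfloor\Big)\,t^{ol+\tilde a}-\frac1{|H|}\hat P_1(t)\Big).$$ (There exists an integer $m$ such that for $l<m$ the contribution in the sum $\sum_{l\in\mathbb{Z}}\max\big(0,\,1+a_0-lb+\sum_{i=1}^\nu\lfloor\frac{-l\omega_i+a_i}{\alpha_i}\rfloor\big)\,t^{ol+\tilde a}$ is zero.)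
   Context: **Seifert invariants.** $M$ is a closed oriented Seifert fibred 3-manifold over $S^2$, with (unnormalized) Seifert invariants $((\alpha_i,\beta_i))_{i=1}^\nu$, $\alpha_i>0$, $\gcd(\alpha_i,\beta_i)=1$, $\nu\ge3$ (the list may include regular fibres, $\alpha_i=1$), and orbifold Euler number $e=-\sum\beta_i/\alpha_i$; $e<0$ iff $M$ is the link of a normal surface singularity. The normalized invariants are given by $e=b+\sum_i\omega_i/\alpha_i$ with $b\in\mathbb{Z}$, $0\le\omega_i<\alpha_i$, $\omega_i\equiv-\beta_i\pmod{\alpha_i}$. Put $\alpha=\mathrm{lcm}(\alpha_1,\dots,\alpha_\nu)$. $H$ (finite, written multiplicatively) is the abelian group generated by $g_0,\dots,g_\nu$ with relations $g_0^{-b}=\prod_i g_i^{\omega_i}$ and $g_0=g_i^{\alpha_i}$ for all $i$, where $g_0$ is the class of the generic fibre; $|H|=\alpha_1\cdots\alpha_\nu|e|$ and $o:=|\langle g_0\rangle|=\alpha|e|$. **$\hat P_\chi$.** For $\chi\in\hat H=\mathrm{Hom}(H,U(1))$ and a free variable $t$, $$\hat P_\chi(t):=\frac{(t^\alpha\chi(g_0)-1)^{\nu-2}}{\prod_{i=1}^\nu(t^{\alpha/\alpha_i}\chi(g_i)-1)}.$$ $\hat P_1$ corresponds to the trivial character $\chi=1$. The series in $t$ converges for $0<|t|<1$. **$spin^c$ structures and torsion.** $Spin^c(M)$ is an $H$-torsor. If $M$ is the link of $(X,0)$, $\sigma_{can}$ is the restriction to $M$ of the $spin^c$ structure on $X\setminus\{0\}$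 induced by its complex structure. $\mathcal{T}_{M,\sigma}=\sum_{h\in H}\mathcal{T}_{M,\sigma}(h)h\in\mathbb{Q}[H]$ is Turaev's sign-refined Reidemeister torsion; $\mathcal{T}_{M,\sigma}(1)$ is the coefficient of the neutral element. In the conventions used, it is determined by $\sum_h\mathcal{T}_{M,\sigma}(h)=0$ and $$\sum_{h\in H}\mathcal{T}_{M,\sigma}(h)\chi(h)=\bar\chi(h_\sigma)\cdot\lim_{t\to1}\hat P_\chi(t)\quad\text{for all }\chi\in\hat H\setminus\{1\}.$$ *)

(* Defs.v *)
From HB Require Import structures.
From mathcomp Require Import all_boot all_order all_algebra all_fingroup.
From mathcomp Require Import all_classical all_reals all_analysis.
From mathcomp Require Import complex.
Set Implicit Arguments.
Unset Strict Implicit.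
Unset Printing Implicit Defensive.
Import Order.TTheory GRing.Theory Num.Theory.
Import numFieldNormedType.Exports.
Local Open Scope classical_set_scope.
Local Open Scope ring_scope.

(* R[i] seen as a [numClosedFieldType], so that it inherits the topology given
   by the modulus: there is no direct topological instance on R[i]. *)
Definition CC (R : realType) : numClosedFieldType := R[i]%C.

(* A closed oriented Seifert 3-manifold over S^2 is given by its unnormalized
   Seifert invariants. *)
Record seifert := Seifert {
  nu : nat;
  sf_alpha : 'I_nu -> nat;
  sf_beta : 'I_nu -> int;
  nu_ge3 : (3 <= nu)%N;
  sf_alpha_gt0 : forall i, (0 < sf_alpha i)%N;
  sf_coprime : forall i, coprimez (sf_alpha i)%:Z (sf_beta i) }.

Section Invariants.
Variable M : seifert.

Definition euler : rat :=
  - \sum_(i < nu M) (sf_beta i)%:~R / (sf_alpha i)%:R.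

(* [divz] rounds down and [modz] is nonnegative for a positive divisor;
   [eulerE] below identifies these with the normalized invariants. *)
Definition omega (i : 'I_(nu M)) : int := (- sf_beta i %% (sf_alpha i)%:Z)%Z.

Definition bnorm : int := \sum_(i < nu M) (- sf_beta i %/ (sf_alpha i)%:Z)%Z.

Definition alphaM : nat := \big[lcmn/1%N]_(i < nu M) sf_alpha i.

(* alpha * (a_0 + \sum_i a_i / alpha_i), an integer; the quotients
   [alphaM %/ sf_alpha i] are exact. *)
Definition atilde (a0 : int) (a : 'I_(nu M) -> int) : int :=
  alphaM%:Z * a0 + \sum_(i < nu M) a i * (alphaM %/ sf_alpha i)%N%:Z.

(* max (0, 1 + a_0 - l b + \sum_i floor ((- l omega_i + a_i) / alpha_i)) *)
Definition series_coef (a0 : int) (a : 'I_(nu M) -> int) (l : int) : int :=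
  Num.max 0 (1 + a0 - l * bnorm
             + \sum_(i < nu M) ((- l * omega i + a i) %/ (sf_alpha i)%:Z)%Z).

Lemma omega_bounds i : 0 <= omega i < (sf_alpha i)%:Z.
Proof.
have a0 : (sf_alpha i)%:Z != 0 by rewrite -lt0n sf_alpha_gt0.
by rewrite modz_ge0 //= ltz_pmod // ltz_nat sf_alpha_gt0.
Qed.

Lemma omega_mod i : (omega i = - sf_beta i %[mod (sf_alpha i)%:Z])%Z.
Proof. exact: modz_mod. Qed.

Lemma eulerE :
  euler = bnorm%:~R + \sum_(i < nu M) (omega i)%:~R / (sf_alpha i)%:R.
Proof.
rewrite /euler /bnorm rmorph_sum -sumrN -big_split /=; apply: eq_bigr => i _.
have a0 : (sf_alpha i)%:R != 0 :> rat by rewrite pnatr_eq0 -lt0n sf_alpha_gt0.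
apply: (mulIf a0); rewrite mulrDl mulNr !divfK // -rmorphN /=.
by rewrite {1}(divz_eq (- sf_beta i) (sf_alpha i)%:Z) rmorphD rmorphM.
Qed.

Lemma atildeE (a0 : int) (a : 'I_(nu M) -> int) :
  (atilde a0 a)%:~R =
    alphaM%:R * (a0%:~R + \sum_(i < nu M) (a i)%:~R / (sf_alpha i)%:R) :> rat.
Proof.
rewrite /atilde rmorphD rmorphM rmorph_sum mulrDr mulr_sumr /=; congr (_ + _).
apply: eq_bigr => i _; rewrite rmorphM /=.
have a1 : (sf_alpha i)%:R != 0 :> rat by rewrite pnatr_eq0 -lt0n sf_alpha_gt0.
apply: (mulIf a1).
have d : (sf_alpha i %| alphaM)%N by rewrite /alphaM (bigD1 i) //= dvdn_lcml.
rewrite -mulrA [in RHS]mulrA divfK ?mulrA //.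
by rewrite -mulrA -[_%:~R * _%:R]natrM divnK // mulrC.
Qed.

End Invariants.

Section HomologyGroup.
Variables (M : seifert) (H : finZmodType).

(* g_0^(c_0) * \prod_i g_i^(c_i); the law of H is written additively. *)
Definition Hword (g0 : H) (g : 'I_(nu M) -> H) (c0 : int)
  (c : 'I_(nu M) -> int) : H := g0 *~ c0 + \sum_(i < nu M) g i *~ c i.

(* (H, g0, g) is the abelian group generated by g_0, ..., g_nu with the
   relations g_0^b * \prod_i g_i^(omega_i) = 1 and g_0 * g_i^(- alpha_i) = 1:
   the map Z^(nu + 1) -> H is onto and its kernel is spanned by the relators. *)
Definition H_presentation (g0 : H) (g : 'I_(nu M) -> H) : Prop :=
  (forall h, exists c0, exists c, h = Hword g0 g c0 c) /\
  (forall c0 c, Hword g0 g c0 c = 0 <->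
     exists (l : int) (m : 'I_(nu M) -> int),
       c0 = l * bnorm M + \sum_(i < nu M) m i /\
       forall i, c i = l * omega i - m i * (sf_alpha i)%:Z).

End HomologyGroup.

Section Torsor.
Variables (H : finZmodType) (S : Type).

Record is_torsor (act : H -> S -> S) : Prop := IsTorsor {
  torsor0 : forall s, act 0 s = s;
  torsorD : forall h k s, act (h + k) s = act h (act k s);
  torsor_simply_transitive : forall s s', exists! h, act h s = s' }.

End Torsor.

Section Characters.
Variables (R : realType) (M : seifert) (H : finZmodType).

Definition is_character (chi : H -> CC R) : Prop :=
  (forall h k, chi (h + k) = chi h * chi k) /\ (forall h, `|chi h| = 1).

Definition trivial_character : H -> CC R := fun=> 1.

Definition Phat (g0 : H) (g : 'I_(nu M) -> H) (chi : H -> CC R) (t : CC R)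
    : CC R :=
  (t ^+ alphaM M * chi g0 - 1) ^+ (nu M - 2)
  / \prod_(i < nu M) (t ^+ (alphaM M %/ sf_alpha i)%N * chi (g i) - 1).

(* T = \sum_h T(h) h in Q[H] is the sign-refined Reidemeister-Turaev torsion of
   (M, sigma), determined by its augmentation and its Fourier transform.  The spin^c structures form the
   H-torsor S, with base point scan for the canonical one. *)
Definition is_torsion (g0 : H) (g : 'I_(nu M) -> H)
    (S : Type) (act : H -> S -> S) (scan sigma : S) (T : H -> rat) : Prop :=
  \sum_(h : H) T h = 0 /\
  forall hsigma, act hsigma scan = sigma ->
  forall chi : H -> CC R, is_character chi -> chi <> trivial_character ->
    \sum_(h : H) ratr (T h) * chi h =
      (chi hsigma)^* * lim (Phat g0 g chi t @[t --> (1 : CC R)^']).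

End Characters.

Section TwoSidedSeries.
Variable R : realType.

(* [Posz n] is n and [Negz n] is - (n + 1). *)
Definition zsummable (u : int -> CC R) : Prop :=
  cvgn (series (fun n => u (Posz n))) /\ cvgn (series (fun n => u (Negz n))).

Definition zsum (u : int -> CC R) : CC R :=
  limn (series (fun n => u (Posz n))) + limn (series (fun n => u (Negz n))).

End TwoSidedSeries.

(* The l-th term of the series; here o = #[g0] is the order of the class g_0 of
   the generic fibre. *)
Definition series_term (R : realType) (M : seifert) (H : finZmodType) (g0 : H)
    (a0 : int) (a : 'I_(nu M) -> int) (t : CC R) (l : int) : CC R :=
  (series_coef a0 a l)%:~R * t ^ (#[g0]%g%:Z * l + atilde a0 a).

(* Main.v *)
(* Put x_i = t^(alpha/alpha_i) g_i and x_0 = t^alpha g_0, so that x_i^alpha_i = x_0 and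
     (x_0 - 1)^(nu-2) / prod_i (x_i - 1)
       = prod_i (sum_(0 <= k_i < alpha_i) x_i^(k_i)) * sum_n (n + 1) x_0^n.
   By the presentation of H, the pairs (n, k) with g_0^n prod_i g_i^(k_i) = h_sigma and
   0 <= k_i < alpha_i are parametrised by l in Z: k_i is the residue of a_i - l omega_i
   modulo alpha_i, n = a_0 - l b + sum_i floor((a_i - l omega_i) / alpha_i), and the
   corresponding monomial is t^(o l + a~).  Hence the series of the theorem is the
   h_sigma-coefficient of this expansion, which by Fourier inversion on H equals
   |H|^-1 sum_chi conj(chi(h_sigma)) Phat_chi(t).  Subtracting the trivial character
   leaves finitely many terms having a limit at t = 1, and Fourier inversion identifies
   the sum of these limits with T(0). *)

Require Import Defs.
From HB Require Import structures.
From mathcomp Require Import all_boot all_order all_algebra all_fingroup.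
From mathcomp Require Import all_solvable all_field.
From mathcomp Require Import all_classical all_reals all_analysis.
From mathcomp Require Import complex ring zify.
Import Order.TTheory GRing.Theory Num.Theory.
Import numFieldNormedType.Exports.
Local Open Scope classical_set_scope.
Local Open Scope ring_scope.

(** * Characters of a finite abelian group *)

Section Dual.
Variables (C : numClosedFieldType) (H : finZmodType).

Lemma zmod_mulrn_card (h : H) : h *+ #|H| = 0.
Proof.
have := @expg_cardG _ [set: H]%G h; rewrite inE cardsT => /(_ isT).
by rewrite FinRing.zmodXgE.
Qed.

(** The polynomial X^m - 1 annihilates A and is separable in characteristic 0, so the minimal
    polynomial of A splits with simple roots. *)
Lemma diagonalizable_unity n (A : 'M[C]_n.+1) m :
  (0 < m)%N -> A ^+ m = 1 -> exists2 P, P \in unitmx & diagonalizable_for P A.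
Proof.
move=> m_gt0 Am1; apply/diagonalizableP.
have [rs rsE] := closed_field_poly_normal ('X^m - 1 : {poly C}).
rewrite lead_coefXnsubC // scale1r in rsE.
exists rs.
  rewrite -separable_prod_XsubC -rsE cyclotomic.separable_Xn_sub_1 //.
  by rewrite pnatr_eq0 -lt0n.
rewrite -rsE; apply: mxminpoly_min.
by rewrite rmorphB rmorphXn /= horner_mx_X Am1 rmorph1 subrr.
Qed.

(* The characters are the joint eigenvalues of the regular representation, whose trace
   is |H| at 0 and vanishes elsewhere. *)
Lemma exists_character_family :
  exists X : 'I_#|H| -> H -> C,
    [/\ forall j h k, X j (h + k) = X j h * X j k,
        forall j, X j 0 = 1 &
        forall h, \sum_j X j h = #|H|%:R * (h == 0)%:R].
Proof.
have H_gt0 : (0 < #|H|)%N by apply/card_gt0P; exists 0.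
have [n Hn] : exists n, #|H| = n.+1 by exists #|H|.-1; rewrite prednK.
pose f (i : 'I_n.+1) : H := enum_val (cast_ord (esym Hn) i).
pose f' h : 'I_n.+1 := cast_ord Hn (enum_rank h).
have fK : cancel f f' by move=> i; rewrite /f /f' enum_valK cast_ordKV.
have f'K : cancel f' f by move=> h; rewrite /f /f' cast_ordK enum_rankK.
pose rho h : 'M[C]_n.+1 := \matrix_(i, j) (f i + h == f j)%:R.
have rhoD h k : rho (h + k) = rho h *m rho k.
  apply/matrixP => i l; rewrite !mxE (bigD1 (f' (f i + h))) //= !mxE !f'K.
  rewrite eqxx mul1r addrA big1 ?addr0 // => j jn; rewrite !mxE.
  case: eqP => [fj|_]; last by rewrite mul0r.
  by rewrite fj fK eqxx in jn.
have rho0 : rho 0 = 1.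
  by apply/matrixP => i j; rewrite !mxE addr0 (can_eq fK).
have rhoX h m : rho h ^+ m = rho (h *+ m).
  by elim: m => [|m IH]; rewrite ?mulr0n ?expr0 // exprS IH mulrS rhoD.
(* The matrices commute because H is abelian, and each is diagonalizable because its |H|-th power is
   1. Hence one P diagonalizes them all. *)
have [P Pu /allP/= Pd] : codiagonalizable [seq rho h | h <- enum H].
  apply/codiagonalizableP; split.
    by move=> _ _ /mapP[h _ ->] /mapP[k _ ->]; rewrite /comm_mx -!rhoD addrC.
  move=> _ /mapP[h _ ->]; apply: (@diagonalizable_unity _ _ #|H|) => //.
  by rewrite rhoX zmod_mulrn_card.
have {Pd}Pd h : {D | P *m rho h *m invmx P = diag_mx D}.
  have /Pd/diagonalizable_forPex/sigW[D] : rho h \in [seq rho h | h <- enum H].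
    by apply: map_f; rewrite mem_enum.
  by move=> /(simmxRL Pu) DE; exists D.
pose D h := sval (Pd h).
have DE h : diag_mx (D h) = P *m rho h *m invmx P by exact/esym/(svalP (Pd h)).
have DX h j : D h 0 j = (P *m rho h *m invmx P) j j.
  by rewrite -DE mxE eqxx mulr1n.
exists (fun j h => D h 0 (cast_ord Hn j)); split.
- move=> j h k; rewrite DX rhoD.
  have -> : P *m (rho h *m rho k) *m invmx P =
     (P *m rho h *m invmx P) *m (P *m rho k *m invmx P).
    by rewrite !mulmxA mulmxKV.
  by rewrite -!DE mulmx_diag !mxE eqxx mulr1n.
- by move=> j; rewrite DX rho0 mulmx1 mulmxV // mxE eqxx.
move=> h; rewrite (reindex (cast_ord (esym Hn))) /=; last first.
  by exists (cast_ord Hn) => i _; rewrite ?cast_ordKV ?cast_ordK.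
under eq_bigr => j _ do rewrite cast_ordKV DX.
rewrite -[LHS]/(\tr _) mxtrace_mulC mulmxA mulVmx // mul1mx.
rewrite /mxtrace; under eq_bigr => i _ do rewrite mxE -subr_eq0 addrC addrA addNr add0r.
by rewrite sumr_const card_ord Hn mulr_natl.
Qed.
End Dual.

(** Values have modulus 1 because their |H|-th power is 1. A character with a value X j k different
    from 1 sums to 0 over H, since translating by k multiplies the sum by X j k. *)
Lemma exists_dual_family (R : realType) (H : finZmodType) :
  exists (X : 'I_#|H| -> H -> CC R) (j0 : 'I_#|H|),
    [/\ forall j, is_character (X j),
        forall h, \sum_j X j h = #|H|%:R * (h == 0)%:R,
        X j0 = @trivial_character R H &
        forall j, j != j0 -> X j <> @trivial_character R H].
Proof.
have [X [XD X0 X_sum]] := exists_character_family (CC R) H.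
have H_gt0 : (0 < #|H|)%N by apply/card_gt0P; exists 0.
have X_char j : is_character (X j).
  split=> [|h]; first exact: XD.
  have XM n : X j (h *+ n) = X j h ^+ n.
    by elim: n => [|n IH]; rewrite ?mulr0n ?expr0 // mulrS XD IH exprS.
  have : `|X j h| ^+ #|H| == 1 by rewrite -normrX -XM zmod_mulrn_card X0 normr1.
  by rewrite pexprn_eq1 // => /orP[|/eqP //]; rewrite eqn0Ngt H_gt0.
pose A := [set j | [forall h, X j h == 1]]%SET.
have sumE j : \sum_h X j h = #|H|%:R * (j \in A)%:R.
  rewrite inE; case: (boolP [forall h, _]) => [/forallP h1|].
    by rewrite mulr1 -sumr_const; apply: eq_bigr => h _; exact/eqP/h1.
  rewrite negb_forall => /existsP[k k1].
  have e : \sum_h X j h = X j k * \sum_h X j h.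
    rewrite {1}(reindex_inj (addrI k)) /= mulr_sumr.
    by apply: eq_bigr => h _; rewrite XD.
  rewrite mulr0; apply/eqP; move/eqP: e.
  by rewrite -subr_eq0 -{1}[\sum_h _]mul1r -mulrBl mulf_eq0 subr_eq0 eq_sym (negPf k1).
(* Double counting: the sum over j and h is |H| when summed first over j, and |H| times the number
   of trivial X j when summed first over h. *)
have /eqP/cards1P[j0 AE] : #|A| = 1%N.
  have : \sum_j \sum_h X j h = #|H|%:R.
    rewrite exchange_big (bigD1 0) //= X_sum eqxx mulr1 big1 ?addr0 //.
    by move=> h /negPf h0; rewrite X_sum h0 mulr0.
  under eq_bigr do rewrite sumE.
  rewrite -mulr_sumr -natr_sum -big_mkcond /= sum1_card -[RHS]mulr1.
  have H0 : #|H|%:R != 0 :> CC R by rewrite pnatr_eq0 -lt0n.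
  by move/(mulfI H0)/eqP; rewrite pnatr_eq1 => /eqP.
exists X, j0; split=> //.
  have : j0 \in A by rewrite AE set11.
  by rewrite inE => /forallP h1; apply/funext => h; exact/eqP/h1.
move=> j jj0 Xj; case/negP: jj0.
have : j \in A by rewrite inE; apply/forallP => h; rewrite Xj.
by rewrite AE inE.
Qed.

(** * Arithmetic of the Seifert invariants *)

Section SeifertArithmetic.
Variable M : seifert.

Definition fibre_weight (i : 'I_(nu M)) : nat := (alphaM M %/ sf_alpha i)%N.

Lemma fibre_weightK i : (fibre_weight i * sf_alpha i)%N = alphaM M.
Proof. by rewrite divnK // /alphaM (bigD1 i) //= dvdn_lcml. Qed.

Lemma alphaM_gt0 : (0 < alphaM M)%N.
Proof.
rewrite /alphaM; elim/big_ind: _ => //.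
- by move=> m n m0 n0; rewrite lcmn_gt0 m0.
- by move=> i _; apply: sf_alpha_gt0.
Qed.

Lemma fibre_weight_gt0 i : (0 < fibre_weight i)%N.
Proof. by have := alphaM_gt0; rewrite -(fibre_weightK i) muln_gt0 => /andP[]. Qed.

(** The integer - alpha e. For e < 0 it is alpha |e|, identified with the order of g_0 in
    [order_g0]. *)
Definition fibre_order : int :=
  - (bnorm M * (alphaM M)%:Z + \sum_i omega i * (fibre_weight i)%:Z).

Lemma fibre_orderE : fibre_order%:~R = - euler M * (alphaM M)%:R :> rat.
Proof.
rewrite /fibre_order eulerE rmorphN mulNr rmorphD /= rmorphM mulrDl.
congr (- (_ + _)); rewrite rmorph_sum mulr_suml /=; apply: eq_bigr => i _.
rewrite rmorphM -mulrA -(fibre_weightK i) natrM; congr (_ * _).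
by rewrite mulrC mulfK // pnatr_eq0 -lt0n sf_alpha_gt0.
Qed.

Lemma fibre_order_gt0 : euler M < 0 -> 0 < fibre_order.
Proof.
move=> he; rewrite -(ltr0z rat) fibre_orderE mulr_gt0 ?oppr_gt0 //.
by rewrite ltr0n alphaM_gt0.
Qed.

Lemma coprime_omega (i : 'I_(nu M)) : coprimez (sf_alpha i)%:Z (omega i).
Proof.
rewrite /coprimez /omega gcdz_modr -/(coprimez _ _).
by rewrite coprimezN sf_coprime.
Qed.

(* Multiplying g_0^(a_0) \prod_i g_i^(a_i) by the l-th power of the relator
   g_0^(-b) \prod_i g_i^(- omega_i), and then moving multiples of alpha_i from g_i to
   g_0, makes the exponent of g_0 equal to [base_exp] and that of g_i to [fibre_exp]. *)
Definition base_exp (a0 : int) (a : 'I_(nu M) -> int) (l : int) : int :=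
  a0 - l * bnorm M + \sum_i ((- l * omega i + a i) %/ (sf_alpha i)%:Z)%Z.

Definition fibre_exp (a : 'I_(nu M) -> int) (l : int) (i : 'I_(nu M)) : int :=
  ((- l * omega i + a i) %% (sf_alpha i)%:Z)%Z.

Lemma fibre_exp_ge0 a l i : 0 <= fibre_exp a l i.
Proof. by rewrite modz_ge0 // eqz_nat -lt0n sf_alpha_gt0. Qed.

Lemma fibre_exp_lt a l i : fibre_exp a l i < (sf_alpha i)%:Z.
Proof. by rewrite ltz_pmod // ltz_nat sf_alpha_gt0. Qed.

Lemma series_coefE a0 a l : series_coef a0 a l = Num.max 0 (base_exp a0 a l + 1).
Proof. by rewrite /series_coef /base_exp; congr Num.max; ring. Qed.

(** Give g_0 weight alpha and g_i weight alpha / alpha_i. Trading g_i^(alpha_i) for g_0 preserves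
    the weight, so only the l-th power of the other relator changes it, by [fibre_order * l]. *)
Lemma degree_exp a0 a l :
  (alphaM M)%:Z * base_exp a0 a l + \sum_i fibre_exp a l i * (fibre_weight i)%:Z
  = fibre_order * l + atilde a0 a.
Proof.
rewrite /base_exp /atilde /fibre_order; move: (bnorm M) => b.
rewrite mulrDr -addrA mulr_sumr -big_split /=.
have -> : \sum_i ((alphaM M)%:Z * ((- l * omega i + a i) %/ (sf_alpha i)%:Z)%Z +
    fibre_exp a l i * (fibre_weight i)%:Z) =
  \sum_i (- l * (omega i * (fibre_weight i)%:Z) + a i * (fibre_weight i)%:Z).
  apply: eq_bigr => i _; rewrite -(fibre_weightK i) PoszM /fibre_exp.
  have := divz_eq (- l * omega i + a i) (sf_alpha i)%:Z.
  move: (_ %/ _)%Z (_ %% _)%Z => q r E.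
  rewrite [RHS](_ : _ = (- l * omega i + a i) * (fibre_weight i)%:Z); last by ring.
  by rewrite E; ring.
by rewrite big_split -mulr_sumr /= /fibre_weight; ring.
Qed.

(** * Consequences of the presentation of H *)

Variables (H : finZmodType) (g0 : H) (g : 'I_(nu M) -> H).
Hypothesis hH : H_presentation g0 g.

Lemma Hword_eq c0 c d0 d :
  Hword g0 g c0 c = Hword g0 g d0 d <->
  exists (l : int) (m : 'I_(nu M) -> int),
    c0 - d0 = l * bnorm M + \sum_i m i /\
    forall i, c i - d i = l * omega i - m i * (sf_alpha i)%:Z.
Proof.
rewrite -(proj2 hH (c0 - d0) (fun i => c i - d i)).
have -> : Hword g0 g (c0 - d0) (fun i => c i - d i) =
  Hword g0 g c0 c - Hword g0 g d0 d.
  rewrite /Hword mulrzBr opprD addrACA -sumrB; congr (_ + _).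
  by apply: eq_bigr => i _; rewrite mulrzBr.
by split=> [->|/eqP]; rewrite ?subrr // subr_eq0 => /eqP.
Qed.

Lemma g_alpha i : g i *+ sf_alpha i = g0.
Proof.
pose d (j : 'I_(nu M)) : int := (i == j)%:Z.
have : Hword g0 g 0 (fun j => d j * (sf_alpha j)%:Z) = Hword g0 g 1 (fun=> 0).
  apply/Hword_eq; exists 0, (fun j => - d j); split.
    rewrite mul0r add0r sumrN (bigD1 i) //= /d eqxx big1 ?addr0 //.
    by move=> j; rewrite eq_sym => /negPf->.
  by move=> j; rewrite /d; case: eqP; lia.
rewrite /Hword mulr0z add0r (bigD1 i) //= /d eqxx mul1r big1 ?addr0; last first.
  by move=> j; rewrite eq_sym => /negPf->; rewrite mul0r mulr0z.
rewrite big1 ?addr0 // => j _; exact: mulr0z.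
Qed.

Lemma relator0 : g0 *~ bnorm M + \sum_i g i *~ omega i = 0.
Proof.
apply/(proj2 hH); exists 1, (fun=> 0); split; first by rewrite big1 // mul1r addr0.
by move=> i; rewrite mul1r mul0r subr0.
Qed.

(** In a relation without g_i, alpha_i divides l omega_i, hence l by coprimality, for every i. So l
    is a multiple of alpha, and the exponent of g_0 is - l / alpha times [fibre_order]. *)
Lemma g0_mulz_eq0 (m : int) : g0 *~ m = 0 <-> (fibre_order %| m)%Z.
Proof.
have -> : g0 *~ m = Hword g0 g m (fun=> 0).
  by rewrite /Hword big1 ?addr0 // => i _; rewrite mulr0z.
rewrite (proj2 hH); split=> [[l [c [-> cE]]]|].
  have [l' lE] : exists l', l = l' * (alphaM M)%:Z.
    suff /dvdzP[q ->] : ((alphaM M)%:Z %| l)%Z by exists q.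
    rewrite dvdzE; apply/dvdn_biglcmP => i _.
    suff : ((sf_alpha i)%:Z %| l)%Z by rewrite dvdzE.
    rewrite -(Gauss_dvdzl _ (coprime_omega i)).
    by apply/dvdzP; exists (c i); move: (cE i); lia.
  apply/dvdzP; exists (- l').
  rewrite /fibre_order mulrNN lE; move: (bnorm M) => b.
  rewrite mulrDr mulr_sumr.
  congr (_ + _); first by ring.
  apply: eq_bigr => i _.
  have a0 : (sf_alpha i)%:Z != 0 by rewrite eqz_nat -lt0n sf_alpha_gt0.
  apply: (mulIf a0); move: (cE i); rewrite lE => ci.
  have := fibre_weightK i => /(congr1 Posz); rewrite PoszM => wE.
  rewrite -!mulrA wE; lia.
move=> /dvdzP[q ->]; exists (- q * (alphaM M)%:Z).
exists (fun i => - q * omega i * (fibre_weight i)%:Z); split.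
  rewrite /fibre_order mulrN -mulNr; move: (bnorm M) => b.
  rewrite mulrDr mulr_sumr; congr (_ + _); first by ring.
  by apply: eq_bigr => i _; rewrite mulrA.
by move=> i; rewrite -(fibre_weightK i) PoszM; ring.
Qed.

Lemma order_g0 : euler M < 0 -> #[g0]%g%:Z = fibre_order.
Proof.
move=> /fibre_order_gt0; case E : fibre_order => [m|//] m_gt0.
congr Posz; apply/eqP; rewrite eqn_dvd; apply/andP; split.
  rewrite cyclic.order_dvdn FinRing.zmodXgE; apply/eqP.
  by apply: (proj2 (g0_mulz_eq0 m)); rewrite E dvdzz.
have : g0 *~ #[g0]%g = 0 by rewrite -pmulrn -FinRing.zmodXgE expg_order.
by move/g0_mulz_eq0; rewrite E dvdzE.
Qed.

(** Equal words differ by relators. Here l counts the relator containing b, and the bounds on k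
    force the multiplicities of the others to be the Euclidean quotients, up to sign. *)
Lemma Hword_expP (a0 : int) (a : 'I_(nu M) -> int) (n : int) (k : 'I_(nu M) -> int) :
  (forall i, 0 <= k i < (sf_alpha i)%:Z) ->
  Hword g0 g n k = Hword g0 g a0 a <->
  exists l, base_exp a0 a l = n /\ fibre_exp a l =1 k.
Proof.
move=> kb; split=> [/esym/Hword_eq[l [m [nE kE]]]|[l [<- kE]]].
  exists l.
  have E i : - l * omega i + a i = - m i * (sf_alpha i)%:Z + k i.
    by move: (kE i); lia.
  have a_neq0 i : (sf_alpha i)%:Z != 0 by rewrite eqz_nat -lt0n sf_alpha_gt0.
  split; last by move=> i; rewrite /fibre_exp E modzMDl modz_small //= kb.
  rewrite /base_exp; under eq_bigr => i _.
    rewrite E divzMDl // divz_small; last exact: kb.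
    rewrite addr0.
    over.
  by rewrite sumrN -[a0](subrK n) nE; ring.
apply/esym/Hword_eq; exists l.
exists (fun i => - ((- l * omega i + a i) %/ (sf_alpha i)%:Z)%Z); split.
  by rewrite /base_exp sumrN; ring.
move=> i; rewrite -kE /fibre_exp mulNr.
have := divz_eq (- l * omega i + a i) (sf_alpha i)%:Z; lia.
Qed.

End SeifertArithmetic.

(** * Convergence in the complex plane *)

Lemma sum_arith_geometric (F : comNzRingType) (x : F) N :
  (\sum_(n < N) n.+1%:R * x ^+ n) * (1 - x) ^+ 2 =
  1 - N%:R * x ^+ N * (1 - x) - x ^+ N.
Proof.
elim: N => [|N IH]; first by rewrite big_ord0 expr0 !mul0r subr0 subrr.
by rewrite big_ord_recr mulrDl IH /= (exprS x N) -natr1; ring.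
Qed.

Section ComplexAnalysis.
Variable R : realType.

(** With s the square root of r, n s^n is at most the sum of the s^i for i < n, which is at most 1 /
    (1 - s). Hence n r^n is at most s^n / (1 - s). *)
Lemma cvgr_natmul_expr (r : R) : 0 <= r < 1 -> n%:R * r ^+ n @[n --> \oo] --> 0.
Proof.
move=> /andP[r_ge0 r_lt1]; pose s := Num.sqrt r.
have s_ge0 : 0 <= s by exact: sqrtr_ge0.
have s2 : s ^+ 2 = r by rewrite sqr_sqrtr.
have s_lt1 : s < 1 by rewrite -(@expr_lt1 _ 2) // s2.
have s1 : `|s| < 1 by rewrite ger0_norm.
have ds : 0 < 1 - s by rewrite subr_gt0.
apply: (@squeeze_cvgr _ _ _ _ (cst 0) (fun n => (1 - s)^-1 * s ^+ n)); last 2 first.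
- exact: cvg_cst.
- by rewrite -(mulr0 (1 - s)^-1); apply: cvgMl_tmp; exact: cvg_expr.
near=> n; rewrite mulr_ge0 ?exprn_ge0 //= -s2 -exprM mul2n -addnn exprD mulrA.
apply: ler_wpM2r; first exact: exprn_ge0.
rewrite -[leRHS]mul1r ler_pdivlMr //.
apply: (@le_trans _ _ (1 - s ^+ n)); last by rewrite lerBlDr lerDl exprn_ge0.
have -> : 1 - s ^+ n = (1 - s) * \sum_(i < n) s ^+ i.
  by rewrite -opprB subrX1 -mulNr opprB.
rewrite mulrC; apply: ler_wpM2l; first exact: ltW.
rewrite mulr_natl -[X in _ *+ X]card_ord -sumr_const; apply: ler_sum => i _.
by apply: ler_wiXn2l => //; [exact: ltW | exact: ltnW].
Unshelve. all: by end_near. Qed.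

Lemma cvgC_natmul_expr (x : CC R) : `|x| < 1 -> n%:R * x ^+ n @[n --> \oo] --> 0.
Proof.
rewrite [X in X < 1]normc_def; set r := Num.sqrt _ => x1.
have r_lt1 : 0 <= r < 1 by rewrite sqrtr_ge0 -ltcR.
apply/cvgr0Pnorm_lt => -[e e'].
(* A positive complex number has zero imaginary part, so its real part serves as the bound in the
   real statement. *)
rewrite ltcE /= => /andP[/eqP-> e_gt0].
have /cvgr0Pnorm_lt/(_ _ e_gt0) := cvgr_natmul_expr _ r_lt1.
apply: filterS => n.
rewrite ger0_norm; last by rewrite mulr_ge0 // exprn_ge0 // (andP r_lt1).1.
rewrite normrM normrX normr_nat normc_def -/r -ltcR.
by rewrite rmorphM rmorphXn rmorph_nat.
Qed.

Lemma cvg_arith_geometric (x : CC R) : `|x| < 1 ->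
  \sum_(n < N) n.+1%:R * x ^+ n @[N --> \oo] --> (1 - x) ^- 2.
Proof.
move=> x1.
have x_neq1 : 1 - x != 0.
  by rewrite subr_eq0; apply: contraTneq x1 => <-; rewrite normr1 ltxx.
have xn0 : x ^+ n @[n --> \oo] --> 0.
  apply/cvgr0Pnorm_lt => e e_gt0.
  have /cvgr0Pnorm_lt/(_ _ e_gt0) := cvgC_natmul_expr _ x1.
  (* For n >= 1, the modulus of x^n is at most that of n x^n. *)
  apply: filterS2 (nbhs_infty_gt 0) => n n_gt0; apply: le_lt_trans.
  by rewrite normrM normr_nat ler_peMl // ler1n.
have E N : \sum_(n < N) n.+1%:R * x ^+ n =
    (1 - N%:R * x ^+ N * (1 - x) - x ^+ N) * (1 - x) ^- 2.
  by rewrite -sum_arith_geometric mulfK // expf_neq0.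
under eq_fun do rewrite E.
have h1 : (1 - n%:R * x ^+ n * (1 - x)) - x ^+ n @[n --> \oo] -->
    1 - 0 * (1 - x) - 0.
  apply: cvgB xn0; apply: cvgB; first exact: cvg_cst.
  exact: (cvgMr_tmp (cvgC_natmul_expr _ x1)).
rewrite mul0r !subr0 in h1; rewrite -[X in nbhs X]mul1r.
exact: (cvgMr_tmp h1).
Qed.

Lemma zsum_shifted (u : int -> CC R) (M0 : nat) (S : CC R) :
  (forall l, l < - M0%:Z -> u l = 0) ->
  \sum_(p < P) u (p%:Z - M0%:Z) @[P --> \oo] --> S ->
  zsummable u /\ zsum u = S.
Proof.
(* A is the sum over - M0 <= l <= -1, because [Negz k] is - (k + 1). It is the whole negative part,
   and the nonnegative part converges to S - A. *)
move=> u0 uS; pose A := \sum_(k < M0) u (Negz k).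
have neg_cvg : series (fun n => u (Negz n)) @ \oo --> A.
  apply: cvg_near_cst; exists M0 => // n /= leMn.
  rewrite seriesEord /= -(subnKC leMn) big_split_ord /= [X in _ + X]big1 ?addr0 //.
  by move=> k _; apply: u0; rewrite NegzE; lia.
have AE : \sum_(p < M0) u (p%:Z - M0%:Z) = A.
  rewrite (reindex_inj rev_ord_inj) /=; apply: eq_bigr => k _.
  by congr u; rewrite NegzE; have := ltn_ord k; lia.
have pos_cvg : series (fun n => u (Posz n)) @ \oo --> S - A.
  rewrite -(cvg_shiftn M0) in uS.
  have -> : series (fun n => u (Posz n)) =
      fun P => \sum_(p < P + M0) u (p%:Z - M0%:Z) - A.
    apply/funext => P; rewrite seriesEord /= addnC big_split_ord /= AE [RHS]addrC addKr.
    by apply: eq_bigr => k _; congr u; lia.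
  exact: (cvgB uS (cvg_cst A)).
have hd := @norm_hausdorff _ (CC R).
split; first by split; [exact: cvgP pos_cvg | exact: cvgP neg_cvg].
by rewrite /zsum (cvg_lim hd pos_cvg) (cvg_lim hd neg_cvg) subrK.
Qed.

End ComplexAnalysis.

(** * The functions Phat *)

Section Characters.
Variables (R : realType) (M : seifert) (H : finZmodType).
Variables (g0 : H) (g : 'I_(nu M) -> H).
Hypothesis hH : H_presentation g0 g.
Variable chi : H -> CC R.
Hypothesis chi_char : is_character chi.

Lemma character0 : chi 0 = 1.
Proof.
have chi0 : chi 0 != 0 by rewrite -normr_eq0 (proj2 chi_char) oner_eq0.
by apply: (mulfI chi0); rewrite -(proj1 chi_char) addr0 mulr1.
Qed.

Lemma characterMn h n : chi (h *+ n) = chi h ^+ n.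
Proof.
elim: n => [|n IH]; first by rewrite mulr0n expr0 character0.
by rewrite mulrS (proj1 chi_char) IH exprS.
Qed.

Lemma character_sum (I : Type) (r : seq I) (P : pred I) (F : I -> H) :
  chi (\sum_(i <- r | P i) F i) = \prod_(i <- r | P i) chi (F i).
Proof. exact: (big_morph chi (proj1 chi_char) character0). Qed.

Lemma characterN h : chi (- h) = (chi h)^*.
Proof.
have h0 : chi h != 0 by rewrite -normr_eq0 (proj2 chi_char) oner_eq0.
apply: (mulfI h0); rewrite -(proj1 chi_char) subrr character0.
by rewrite -normCK (proj2 chi_char) expr1n.
Qed.

Lemma character_ker_mulz h (z : int) : chi h = 1 -> chi (h *~ z) = 1.
Proof.
move=> h1; case: z => n; first by rewrite -pmulrn characterMn h1 expr1n.
by rewrite NegzE mulrNz characterN -pmulrn characterMn h1 expr1n conjC1.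
Qed.

Lemma character_ker_Hword c0 c :
  chi g0 = 1 -> (forall i, chi (g i) = 1) -> chi (Hword g0 g c0 c) = 1.
Proof.
move=> h0 h; rewrite (proj1 chi_char) character_sum character_ker_mulz // mul1r.
by rewrite big1 // => i _; exact: character_ker_mulz.
Qed.

Lemma character_g_alpha i : chi (g i) ^+ sf_alpha i = chi g0.
Proof. by rewrite -characterMn (g_alpha _ _ _ _ hH). Qed.

(* If all but one of the chi (g_i) are 1 then chi g_0 = 1, so the last one, c, satisfies
   c^alpha_i = c^omega_i = 1 and is 1 by coprimality. *)
Lemma two_nontrivial_fibres : chi <> @trivial_character R H ->
  exists i j, [/\ i != j, chi (g i) != 1 & chi (g j) != 1].
Proof.
move=> chi_neq1; have nu3 := nu_ge3 M.
have all1 : ~ forall i, chi (g i) = 1.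
  move=> h; apply: chi_neq1; apply/funext => x.
  have [c0 [c ->]] := proj1 hH x.
  apply: character_ker_Hword => //.
  by rewrite -(character_g_alpha (Ordinal (ltnW (ltnW nu3)))) h expr1n.
have /existsP[i ci] : [exists i, chi (g i) != 1].
  apply: contra_notT all1; rewrite negb_exists => /forallP h i.
  by apply/eqP; have := h i; rewrite negbK.
exists i.
have /existsP[j /andP[ji cj]] : [exists j, (j != i) && (chi (g j) != 1)].
  apply: contraT; rewrite negb_exists => /forallP h.
  have {}h j : j != i -> chi (g j) = 1.
    by move=> ji; apply/eqP; have := h j; rewrite ji negbK.
  have [j ji] : exists j, j != i.
    have [->|] := eqVneq i (Ordinal (ltnW (ltnW nu3))).
      by exists (Ordinal (ltnW nu3)).
    by rewrite eq_sym; exists (Ordinal (ltnW (ltnW nu3))).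
  have c0 : chi g0 = 1 by rewrite -(character_g_alpha j) h // expr1n.
  have ca : chi (g i *~ (sf_alpha i)%:Z) = 1.
    by rewrite -pmulrn characterMn character_g_alpha.
  have co : chi (g i *~ omega i) = 1.
    have := congr1 chi (relator0 _ _ _ _ hH).
    rewrite (bigD1 i) //= !(proj1 chi_char) character0 character_ker_mulz // mul1r.
    rewrite character_sum big1 ?mulr1 // => k ki.
    exact/character_ker_mulz/h.
  have /coprimezP[[u v] /= uv] := coprime_omega _ i.
  have : chi (g i *~ (u * (sf_alpha i)%:Z + v * omega i)) = 1.
    rewrite mulrzDr (proj1 chi_char) [u * _]mulrC [v * _]mulrC !mulrzA.
    by rewrite (character_ker_mulz _ _ ca) (character_ker_mulz _ _ co) mulr1.
  by rewrite uv mulr1z => /eqP; rewrite (negPf ci).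
by exists j; rewrite eq_sym.
Qed.

End Characters.

Lemma cvg_exprn (K : numFieldType) (T : Type) (F : set_system T) {FF : Filter F}
  (f : T -> K) (a : K) n : f x @[x --> F] --> a -> f x ^+ n @[x --> F] --> a ^+ n.
Proof.
move=> fa; elim: n => [|n IH]; first by under eq_fun do rewrite expr0; exact: cvg_cst.
by rewrite exprS; under eq_fun do rewrite exprS; exact: cvgM.
Qed.

Section Convergence.
Variable K : numFieldType.

(** If c is not 1, then t^n c - 1 has a nonzero limit. If c = 1, it is t - 1 times a geometric sum
    tending to n. *)
Lemma near_expr_neq1 (c : K) n : (0 < n)%N -> \forall t \near (1 : K)^', t ^+ n * c != 1.
Proof.
move=> n_gt0.
have tX m : t ^+ m @[t --> (1 : K)^'] --> (1 : K).
  have id_cvg : id t @[t --> (1 : K)^'] --> (1 : K) by exact: nbhs_dnbhs.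
  by have := cvg_exprn _ _ _ _ _ m id_cvg; rewrite expr1n; apply.
have [->|c1] := eqVneq c 1.
  have : (\sum_(k < n) t ^+ k) @[t --> (1 : K)^'] --> \sum_(k < n) (1 : K).
    apply: cvg_big => [|k _]; first exact: add_continuous.
    exact: tX.
  move=> /cvgr_neq0; rewrite sumr_const card_ord pnatr_eq0 -lt0n => /(_ n_gt0) h.
  have h1 : \forall t \near (1 : K)^', t != 1 by exact: nbhs_dnbhs_neq.
  apply: filterS2 h h1 => t st t1.
  by rewrite mulr1 -subr_eq0 subrX1 mulf_neq0 // subr_eq0.
have : (t ^+ n * c - 1) @[t --> (1 : K)^'] --> (1 * c - 1).
  apply: cvgB; last exact: cvg_cst.
  by apply: cvgMr_tmp; exact: tX.
move=> /cvgr_neq0; rewrite mul1r subr_eq0 => /(_ c1).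
by apply: filterS => t; rewrite subr_eq0.
Qed.

End Convergence.

Section PhatFormulas.
Variables (R : realType) (M : seifert) (H : finZmodType).
Variables (g0 : H) (g : 'I_(nu M) -> H).
Hypothesis hH : H_presentation g0 g.
Variable chi : H -> CC R.
Hypothesis chi_char : is_character chi.

Definition fibre_var (t : CC R) (i : 'I_(nu M)) : CC R :=
  t ^+ fibre_weight M i * chi (g i).

Lemma fibre_varX t i : fibre_var t i ^+ sf_alpha i = t ^+ alphaM M * chi g0.
Proof.
rewrite /fibre_var exprMn_comm; last exact: mulrC.
by rewrite -exprM fibre_weightK (character_g_alpha _ _ _ _ _ hH).
Qed.

Definition fibre_sum (t : CC R) (i : 'I_(nu M)) : CC R :=
  \sum_(k < sf_alpha i) fibre_var t i ^+ k.

Lemma fibre_sumE t i :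
  t ^+ alphaM M * chi g0 - 1 = (fibre_var t i - 1) * fibre_sum t i.
Proof. by rewrite -(fibre_varX t i) subrX1. Qed.

(** Each x_0 - 1 equals (x_i - 1) [fibre_sum]. Multiplying by (x_0 - 1)^2 turns the numerator into
    nu such factors, one for each i; |t| < 1 keeps every denominator nonzero. *)
Lemma Phat_small t : `|t| < 1 ->
  Phat g0 g chi t = (1 - t ^+ alphaM M * chi g0) ^- 2 * \prod_i fibre_sum t i.
Proof.
move=> t1.
have x1 n h : (0 < n)%N -> t ^+ n * chi h - 1 != 0.
  move=> n_gt0; rewrite subr_eq0; apply: contraTneq t1 => e.
  have : `|t ^+ n * chi h| = 1 by rewrite e normr1.
  rewrite normrM (proj2 chi_char) mulr1 normrX => /eqP.
  by rewrite pexprn_eq1 // => /orP[/eqP n0|/eqP->]; [lia | rewrite ltxx].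
have x01 : t ^+ alphaM M * chi g0 - 1 != 0 by apply: x1; exact: alphaM_gt0.
have d0 : \prod_i (fibre_var t i - 1) != 0.
  by apply/prodf_neq0 => i _; apply: x1; exact: fibre_weight_gt0.
rewrite /Phat -/(fibre_weight _ _) -/(fibre_var _ _).
apply: (mulIf d0); rewrite mulfVK // -mulrA -big_split /=.
under eq_bigr => i _ do rewrite mulrC -fibre_sumE.
rewrite prodr_const card_ord -sqrrN opprB.
apply: (mulfI (expf_neq0 2 x01)); rewrite mulrA mulfV ?expf_neq0 // mul1r -exprD.
by rewrite subnKC // ltnW // nu_ge3.
Qed.

(** The nu - 2 factors of the numerator cancel all denominators except those of i and j. Choosing i
    and j with nontrivial character values leaves an expression that is continuous at t = 1. *)
Lemma Phat_split t i j : i != j -> (forall k, fibre_var t k != 1) ->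
  Phat g0 g chi t = (\prod_(k | (k != i) && (k != j)) fibre_sum t k)
    / ((fibre_var t i - 1) * (fibre_var t j - 1)).
Proof.
move=> ij x1; have d0 k : fibre_var t k - 1 != 0 by rewrite subr_eq0.
rewrite /Phat -/(fibre_weight _ _) -/(fibre_var _ _).
rewrite (bigD1 i) //= (bigD1 j) //=; last by rewrite eq_sym.
have -> : (t ^+ alphaM M * chi g0 - 1) ^+ (nu M - 2) =
  \prod_(k | (k != i) && (k != j)) (t ^+ alphaM M * chi g0 - 1).
  rewrite prodr_const; congr (_ ^+ _).
  have := cardC (pred2 i j); rewrite card2 ij card_ord => /(canRL (addKn _)).
  by move=> /= <-; apply: eq_card => k; rewrite !inE negb_or unfold_in.
under eq_bigr => k _ do rewrite (fibre_sumE t k).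
rewrite big_split /=.
have p0 : \prod_(k | (k != i) && (k != j)) (fibre_var t k - 1) != 0.
  by apply/prodf_neq0.
by rewrite [_ * \prod_(k | _) fibre_sum t k]mulrC [in LHS]mulrA -mulf_div divff // mulr1.
Qed.

Lemma Phat_cvg : chi <> @trivial_character R H ->
  exists L : CC R, Phat g0 g chi t @[t --> (1 : CC R)^'] --> L.
Proof.
move=> /(two_nontrivial_fibres _ _ _ _ _ hH _ chi_char)[i [j [ij ci cj]]].
have vE k : fibre_var t k @[t --> (1 : CC R)^'] --> chi (g k).
  have id_cvg : id t @[t --> (1 : CC R)^'] --> (1 : CC R) by exact: nbhs_dnbhs.
  have := cvg_exprn _ _ _ _ _ (fibre_weight M k) id_cvg.
  rewrite expr1n => tk; have := @cvgMr_tmp _ _ _ _ _ _ (chi (g k)) (tk _).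
  by rewrite mul1r; apply.
exists ((\prod_(k | (k != i) && (k != j)) \sum_(m < sf_alpha k) chi (g k) ^+ m)
    * ((chi (g i) - 1) * (chi (g j) - 1))^-1).
have h : \forall t \near (1 : CC R)^', forall k, fibre_var t k != 1.
  apply: filter_forall => k; apply: near_expr_neq1; exact: fibre_weight_gt0.
have P : (\prod_(k | (k != i) && (k != j)) fibre_sum t k)
    * ((fibre_var t i - 1) * (fibre_var t j - 1))^-1 @[t --> (1 : CC R)^'] -->
  (\prod_(k | (k != i) && (k != j)) \sum_(m < sf_alpha k) chi (g k) ^+ m)
    * ((chi (g i) - 1) * (chi (g j) - 1))^-1.
  apply: cvgM.
    apply: cvg_big => [|k _]; first exact: mul_continuous.
    apply: cvg_big => [|m _]; first exact: add_continuous.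
    apply: cvg_exprn; exact: vE.
  apply: cvgV; first by rewrite mulf_neq0 // subr_eq0.
  have v1 k : fibre_var t k - 1 @[t --> (1 : CC R)^'] --> chi (g k) - 1.
    exact: (cvgB (vE k) (cvg_cst (1 : CC R))).
  exact: (cvgM (v1 i) (v1 j)).
apply: cvg_trans P; apply: near_eq_cvg.
by apply: filterS h => t /(Phat_split _ _ _ ij).
Qed.

End PhatFormulas.

(** * Rearrangement of the series *)

Section Rearrangement.
Variables (R : realType) (M : seifert).
Hypothesis he : euler M < 0.
Variables (H : finZmodType) (g0 : H) (g : 'I_(nu M) -> H).
Hypothesis hH : H_presentation g0 g.
Variables (a0 : int) (a : 'I_(nu M) -> int).

(** As o >= 1, the exponent o l + a~ is negative for l < - [shift]. The constant [base_deg] is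
    chosen so that adding it to this exponent gives o (l + [shift]). *)
Let o : nat := `|fibre_order M|%N.
Let shift : nat := `|atilde a0 a|%N.
Let base_deg : nat := absz (o%:Z * shift%:Z - atilde a0 a)%R.

Let oE : fibre_order M = o%:Z.
Proof. by rewrite /o gtz0_abs // fibre_order_gt0. Qed.

Let o_gt0 : (0 < o)%N.
Proof. by have := fibre_order_gt0 M he; rewrite oE. Qed.

Let base_degE : base_deg%:Z = o%:Z * shift%:Z - atilde a0 a.
Proof.
rewrite /base_deg gez0_abs //; have := o_gt0; rewrite /shift; nia.
Qed.

Notation exps := {ffun 'I_(nu M) -> 'I_(alphaM M)}.

Definition term_deg (n : nat) (k : exps) : nat :=
  (alphaM M * n + \sum_i k i * fibre_weight M i)%N.

(** The relation that l is the parameter of the monomial x_0^n prod_i x_i^(k_i). *)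
Definition hits (l : int) (n : nat) (k : exps) : bool :=
  (base_exp M a0 a l == n%:Z) && [forall i, fibre_exp M a l i == (k i)%:Z].

Lemma hits_deg l n k : hits l n k -> (term_deg n k)%:Z = o%:Z * l + atilde a0 a.
Proof.
move=> /andP[/eqP nE /forallP kE]; rewrite -oE -degree_exp nE PoszD PoszM.
congr (_ + _); rewrite (big_morph Posz PoszD erefl); apply: eq_bigr => i _.
by rewrite PoszM (eqP (kE i)).
Qed.

(** The total weight o l + a~ is negative while the fibre exponents are nonnegative, so the exponent
    of g_0 is negative. *)
Lemma series_coef_small l : l < - shift%:Z -> series_coef a0 a l = 0.
Proof.
move=> l_lt; rewrite series_coefE; apply/max_idPl.
have := degree_exp M a0 a l; rewrite oE => dE.
have f_ge0 : 0 <= \sum_i fibre_exp M a l i * (fibre_weight M i)%:Z.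
  by apply: sumr_ge0 => i _; rewrite mulr_ge0 ?fibre_exp_ge0.
have neg : o%:Z * l + atilde a0 a < 0 by move: l_lt o_gt0; rewrite /shift; nia.
rewrite -ltzD1 ltrD2r; have := alphaM_gt0 M; nia.
Qed.

(** A parameter exists exactly when the word represents the given class. It is unique since the
    degree determines l, and the degree bound places it in the range of summation. *)
Lemma sum_hits P n (k : exps) : (forall i, k i < sf_alpha i)%N ->
  (term_deg n k + base_deg < o * P)%N ->
  \sum_(p < P) (hits (p%:Z - shift%:Z) n k)%:R =
  (Hword g0 g n (fun i => (k i)%:Z) == Hword g0 g a0 a)%:R :> CC R.
Proof.
move=> kb dP.
have := @Hword_expP M H g0 g hH a0 a n (fun i => (k i)%:Z) => /(_ kb) W.
case: eqP => [/W[l [nE kE]]|nW]; last first.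
  rewrite big1 // => p _; case: (boolP (hits _ _ _)) => // /andP[/eqP nE /forallP kE].
  by case: nW; apply/W; exists (p%:Z - shift%:Z); split=> // i; exact/eqP.
have hl : hits l n k by rewrite /hits nE eqxx; apply/forallP => i; rewrite kE.
have dE := hits_deg _ _ _ hl.
have E : (term_deg n k + base_deg)%:Z = o%:Z * (l + shift%:Z).
  by rewrite PoszD dE base_degE; ring.
have oz_gt0 : 0 < o%:Z by rewrite ltz_nat.
have l_ge : 0 <= l + shift%:Z by rewrite -(pmulr_rge0 _ oz_gt0) -E.
have l_lt : l + shift%:Z < P%:Z by rewrite -(ltr_pM2l oz_gt0) -E -PoszM ltz_nat.
have [q qE] : exists q : nat, l + shift%:Z = q%:Z by exists (absz (l + shift%:Z)%R); lia.
have qP : (q < P)%N by rewrite -ltz_nat -qE.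
rewrite (bigD1 (Ordinal qP)) //= -qE addrK hl big1 ?addr0 // => p pq.
case: (boolP (hits _ _ _)) => // /hits_deg; rewrite dE => e.
suff /eqP pE : p%:Z == q%:Z by case/eqP: pq; apply/val_inj; case: pE.
by move: e => /addIr/(mulfI (lt0r_neq0 oz_gt0)) e; rewrite -qE e subrK.
Qed.

(* Cutting the sum over l at l < P - shift amounts to cutting, for each k, the sum over
   n at n < trunc k P. *)
Definition trunc (k : exps) (P : nat) : nat :=
  (((o * P - (\sum_i k i * fibre_weight M i + base_deg)) + (alphaM M).-1) %/ alphaM M)%N.

(** [trunc] is a quotient by alpha rounded up, with subtraction truncated at 0, and n lies below
    such a quotient exactly when alpha n lies below the dividend. *)
Lemma ltn_trunc k P n : (n < trunc k P)%N = (term_deg n k + base_deg < o * P)%N.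
Proof.
rewrite /trunc leq_divRL ?alphaM_gt0 // /term_deg; have := alphaM_gt0 M.
by move: (\sum_i _)%N (o * P)%N => s x; nia.
Qed.

Lemma trunc_cvg k : trunc k P @[P --> \oo] --> \oo.
Proof.
move=> A [N _ NA]; exists (N.+1 * alphaM M + \sum_i k i * fibre_weight M i + base_deg)%N => //.
move=> P /= hP; apply: NA => /=; apply: ltnW; rewrite ltn_trunc /term_deg.
apply: leq_trans (leq_pmull P o_gt0); apply: leq_trans hP.
by rewrite !ltn_add2r mulSn mulnC -[ltnLHS]add0n ltn_add2r alphaM_gt0.
Qed.

(* The k with 0 <= k_i < alpha_i are encoded as functions into the common type
   'I_alpha, so that the product of sums can be expanded. *)
Definition in_box (i : 'I_(nu M)) : pred 'I_(alphaM M) :=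
  fun j => (j < sf_alpha i)%N.

Lemma series_term_expand (t : CC R) (P : nat) (p : 'I_P) :
  series_term g0 a0 a t (p%:Z - shift%:Z) =
  \sum_(k in family in_box) \sum_(n < trunc k P)
    (hits (p%:Z - shift%:Z) n k)%:R * (n.+1%:R * t ^+ term_deg n k).
Proof.
set l := p%:Z - shift%:Z.
rewrite /series_term (order_g0 _ _ _ _ hH he) oE series_coefE.
(* A negative exponent of g_0 gives coefficient 0 and matches no n. Otherwise the only matching pair
   is n and the residues k, with coefficient n + 1. *)
case E : (base_exp M a0 a l) => [n|n]; last first.
  rewrite max_l ?mul0r; last by rewrite NegzE; lia.
  rewrite big1 // => k _; rewrite big1 // => m _.
  by rewrite /hits E mul0r.
have fb i : (`|fibre_exp M a l i|%N < alphaM M)%N.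
  have := fibre_exp_ge0 M a l i; have := fibre_exp_lt M a l i.
  have : (sf_alpha i <= alphaM M)%N.
    by rewrite -(fibre_weightK M i) leq_pmull // fibre_weight_gt0.
  lia.
pose k : exps := [ffun i => Ordinal (fb i)].
have kE i : (k i)%:Z = fibre_exp M a l i.
  by rewrite ffunE /= gez0_abs // fibre_exp_ge0.
have kfam : k \in family in_box.
  by apply/familyP => i; rewrite unfold_in -ltz_nat kE fibre_exp_lt.
have hk : hits l n k by rewrite /hits E eqxx; apply/forallP => i; rewrite kE.
have dE := hits_deg _ _ _ hk.
(* The shifted degree is o p, which is less than o P because p < P. *)
have nk : (n < trunc k P)%N.
  rewrite ltn_trunc -ltz_nat PoszD dE base_degE PoszM /l.
  have := ltn_ord p; have := o_gt0; nia.
rewrite (bigD1 k) //= [X in _ = _ + X]big1 ?addr0; last first.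
  move=> k' /andP[_ k'k]; rewrite big1 // => m _.
  case: (boolP (hits _ _ _)) => [/andP[_ /forallP h]|]; last by rewrite mul0r.
  case/eqP: k'k; apply/ffunP => i; apply/val_inj => /=.
  by have := h i; rewrite -kE => /eqP [].
rewrite (bigD1 (Ordinal nk)) //= [X in _ = _ + X]big1 ?addr0; last first.
  move=> m mn; case: (boolP (hits _ _ _)) => [/andP[/eqP h _]|]; last by rewrite mul0r.
  by case/eqP: mn; apply/val_inj; move: h; rewrite E => -[].
rewrite hk mul1r -dE; congr (_ * _).
by rewrite max_r // -PoszD addn1.
Qed.

Lemma partial_sum_expand (t : CC R) (P : nat) :
  \sum_(p < P) series_term g0 a0 a t (p%:Z - shift%:Z) =
  \sum_(k in family in_box) \sum_(n < trunc k P)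
    (Hword g0 g n (fun i => (k i)%:Z) == Hword g0 g a0 a)%:R
      * (n.+1%:R * t ^+ term_deg n k).
Proof.
under eq_bigr => p _ do rewrite series_term_expand.
rewrite exchange_big /=; apply: eq_bigr => k kfam.
rewrite exchange_big /=; apply: eq_bigr => n _.
rewrite -mulr_suml sum_hits //; last by rewrite -ltn_trunc.
by move=> i; have /familyP/(_ i) := kfam.
Qed.

(** * Fourier expansion of the series over the characters of H *)

Section Fourier.
Variable X : 'I_#|H| -> H -> CC R.
Hypothesis X_char : forall j, is_character (X j).
Hypothesis X_sum : forall h, \sum_j X j h = #|H|%:R * (h == 0)%:R.

Lemma indicator_fourier (h h' : H) :
  (h == h')%:R = #|H|%:R^-1 * \sum_j (X j h')^* * X j h :> CC R.
Proof.
have H0 : #|H|%:R != 0 :> CC R.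
  by rewrite pnatr_eq0 -lt0n; apply/card_gt0P; exists 0.
rewrite -subr_eq0; apply: (mulfI H0); rewrite mulVKf // -X_sum.
by apply: eq_bigr => j _; rewrite (X_char j).1 (characterN _ _ _ (X_char j)) mulrC.
Qed.

Lemma zsum_Phat (t : CC R) : 0 < `|t| < 1 ->
  zsummable (series_term g0 a0 a t) /\
  zsum (series_term g0 a0 a t) =
    #|H|%:R^-1 * \sum_j (X j (Hword g0 g a0 a))^* * Phat g0 g (X j) t.
Proof.
move=> /andP[_ t1]; apply: (@zsum_shifted _ _ shift).
  by move=> l l_lt; rewrite /series_term series_coef_small // mul0r.
under eq_fun do rewrite partial_sum_expand.
set h := Hword g0 g a0 a.
pose x0 j := t ^+ alphaM M * X j g0.
have x0_lt1 j : `|x0 j| < 1.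
  rewrite /x0 normrM (X_char j).2 mulr1 normrX exprn_ilt1 //.
  by rewrite -lt0n alphaM_gt0.
(* The indicator of the class becomes an average over characters, and each character turns t^(deg)
   into the product of x_0^n and the x_i^(k_i). *)
have termE (k : exps) N : \sum_(n < N) (Hword g0 g n (fun i => (k i)%:Z) == h)%:R
      * (n.+1%:R * t ^+ term_deg n k) =
    #|H|%:R^-1 * \sum_j ((X j h)^* * \prod_i fibre_var R M H g (X j) t i ^+ k i) *
      \sum_(n < N) n.+1%:R * x0 j ^+ n.
  under eq_bigr => n _ do rewrite indicator_fourier -mulrA mulr_suml.
  rewrite -mulr_sumr; congr (_ * _).
  rewrite exchange_big /=; apply: eq_bigr => j _; rewrite mulr_sumr.
  apply: eq_bigr => n _; rewrite -!mulrA; congr (_ * _).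
  rewrite /Hword (X_char j).1 (character_sum _ _ _ (X_char j)) -pmulrn.
  rewrite (characterMn _ _ _ (X_char j)) /term_deg exprD exprM /x0.
  rewrite [(t ^+ _ * X j g0) ^+ n]exprMn.
  have -> : \prod_i fibre_var R M H g (X j) t i ^+ k i =
      t ^+ (\sum_i k i * fibre_weight M i) * \prod_i X j (g i *~ (k i)%:Z).
    rewrite -prodrXr -big_split /=; apply: eq_bigr => i _.
    rewrite /fibre_var exprMn -exprM mulnC -pmulrn.
    by rewrite (characterMn _ _ _ (X_char j)).
  move: (t ^+ _) (t ^+ _ ^+ n) (X j g0 ^+ n) (\prod_i _) (n.+1%:R) => A B C D E.
  rewrite [C * D]mulrC [A * D]mulrC -!mulrA; congr (D * _).
  by rewrite [LHS]mulrC [RHS]mulrC -!mulrA; do 2 congr (_ * _); rewrite mulrC.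
have -> : #|H|%:R^-1 * \sum_j (X j h)^* * Phat g0 g (X j) t =
  \sum_(k in family in_box) #|H|%:R^-1 * \sum_j
    ((X j h)^* * \prod_i fibre_var R M H g (X j) t i ^+ k i) * (1 - x0 j) ^- 2.
  rewrite -mulr_sumr exchange_big /=; congr (_ * _); apply: eq_bigr => j _.
  rewrite -mulr_suml -mulr_sumr -mulrA; congr (_ * _).
  rewrite (Phat_small _ _ _ _ _ hH _ (X_char j) _ t1) mulrC; congr (_ * _).
  (* Distributivity: the sum over the box of exponents k factors as the product of the geometric
     sums [fibre_sum]. *)
  rewrite -(bigA_distr_big_dep _ (fun i (m : 'I_(alphaM M)) =>
     fibre_var R M H g (X j) t i ^+ m)); apply: eq_bigr => i _.
  rewrite /fibre_sum (big_ord_widen (alphaM M) (fun m => fibre_var R M H g (X j) t i ^+ m)) //.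
  by rewrite -(fibre_weightK M i) leq_pmull // fibre_weight_gt0.
apply: cvg_big => [|k _]; first exact: add_continuous.
under eq_fun do rewrite termE.
apply: cvgMl_tmp; apply: cvg_big => [|j _]; first exact: add_continuous.
apply: cvgMl_tmp.
(* With k and j ranging over finite sets, it remains to pass to the limit in each
   arithmetic-geometric sum, whose cutoff tends to infinity with P. *)
exact: (cvg_comp _ _ (trunc_cvg k) (cvg_arith_geometric _ _ (x0_lt1 j))).
Qed.

End Fourier.
End Rearrangement.

(** * The limit at t = 1 and the torsion *)

Theorem proposition3p10 (R : realType) (M : seifert) (he : euler M < 0)
  (H : finZmodType) (g0 : H) (g : 'I_(nu M) -> H)
  (hH : H_presentation g0 g)
  (Spinc : Type) (act : H -> Spinc -> Spinc) (hact : is_torsor act)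
  (sigma_can sigma : Spinc)
  (T : H -> rat)
  (hT : is_torsion R g0 g act sigma_can sigma T)
  (h_sigma : H) (hsigma : act h_sigma sigma_can = sigma)
  (a0 : int) (a : 'I_(nu M) -> int)
  (ha : h_sigma = Hword g0 g a0 a) :
  (exists m : int, forall l : int, l < m -> series_coef a0 a l = 0) /\
  (forall t : CC R, 0 < `|t| < 1 ->
     zsummable (series_term g0 a0 a t)) /\
  (zsum (series_term g0 a0 a t)
     - (#|H|%:R)^-1 * Phat g0 g (@trivial_character R H) t)
    @[t --> within [set t : CC R | 0 < `|t| < 1] (nbhs (1 : CC R))]
    --> (ratr (T 0) : CC R).
Proof.
have [X [j0 [X_char X_sum Xj0 Xj]]] := exists_dual_family R H.
have Z := zsum_Phat R M he H g0 g hH a0 a X X_char X_sum.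
split; first by eexists; exact: (series_coef_small M he).
split; first by move=> t /Z[].
pose L j := lim (Phat g0 g (X j) t @[t --> (1 : CC R)^']).
have LP j : j != j0 -> Phat g0 g (X j) t @[t --> (1 : CC R)^'] --> L j.
  move=> /Xj Xn; have [l Pl] := Phat_cvg _ _ _ _ _ hH _ (X_char j) Xn.
  by rewrite /L (cvg_lim (@norm_hausdorff _ (CC R)) Pl).
(* Inversion at 0: the sum of all characters isolates |H| T(0). After exchanging sums, the trivial
   character contributes the augmentation, which is 0. *)
have TE : ratr (T 0) = #|H|%:R^-1 * \sum_(j | j != j0) (X j h_sigma)^* * L j :> CC R.
  have H0 : #|H|%:R != 0 :> CC R.
    by rewrite pnatr_eq0 -lt0n; apply/card_gt0P; exists 0.
  apply: (mulfI H0); rewrite mulVKf //.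
  transitivity (\sum_h ratr (T h) * \sum_j X j h : CC R).
    rewrite (bigD1 0) //= X_sum eqxx mulr1 mulrC big1 ?addr0 //.
    by move=> h /negPf h0; rewrite X_sum h0 !mulr0.
  under eq_bigr => h _ do rewrite mulr_sumr.
  rewrite exchange_big (bigD1 j0) //= [X in X + _ = _](_ : _ = 0) ?add0r.
    by apply: eq_bigr => j jj0; exact: ((proj2 hT) _ hsigma _ (X_char j) (Xj _ jj0)).
  rewrite Xj0 /trivial_character; under eq_bigr do rewrite mulr1.
  by rewrite -rmorph_sum (proj1 hT) rmorph0.
(* The subtracted term is exactly the contribution of the trivial character to [zsum]. *)
have D : \forall t \near within [set t : CC R | 0 < `|t| < 1] (nbhs (1 : CC R)),
    #|H|%:R^-1 * \sum_(j | j != j0) (X j h_sigma)^* * Phat g0 g (X j) t =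
    zsum (series_term g0 a0 a t)
     - (#|H|%:R)^-1 * Phat g0 g (@trivial_character R H) t.
  apply: filterS (near_withinT _ _) => t /= /Z[_ ->]; rewrite -ha -Xj0 [in RHS](bigD1 j0) //=.
  have -> : (X j0 h_sigma)^* = 1 by rewrite Xj0 conjC1.
  by rewrite mul1r mulrDr addrAC subrr add0r.
apply: cvg_trans (near_eq_cvg D) _.
rewrite TE.
(* The region 0 < |t| < 1 omits t = 1, so limits along the punctured neighbourhood restrict to
   it. *)
have sub : within [set t : CC R | 0 < `|t| < 1] (nbhs (1 : CC R)) `=>` (1 : CC R)^'.
  move=> A; rewrite /dnbhs /within /=; apply: filterS => t At /andP[_ t1].
  by apply: At; apply: contraTneq t1 => ->; rewrite normr1 ltxx.
apply: cvg_trans (cvg_app _ sub) _.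
apply: cvgMl_tmp; apply: cvg_big => [|j jj0]; first exact: add_continuous.
exact: (cvgMl_tmp (LP j jj0)).
Qed.
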